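(* Let $F$ be an almost Dedekind $\sigma$-complete Riesz space and let $F^\sigma$ be its sequential order closure. Then the Riesz completion $\mathcal{L}^n(\ell^\infty_0,F)^\rho$ of $\mathcal{L}^n(\ell^\infty_0,F)$ may be identified with the Riesz space of operators $$H_n=\{T\in\mathcal{L}^n(\ell^\infty_0,F^\sigma):Te_n\in F\ \text{for all } n\in\mathbb{N}\}.$$ That is, with the pointwise linear operations and the operator order, $H_n$ is a Riesz space, and $\mathcal{L}^n(\ell^\infty_0,F)$, regarded as a subspace of $H_n$ via the inclusion $F\subseteq F^\sigma$, is order dense in $H_n$ and generates $H_n$ as a Riesz space.
   Context: $\ell^\infty_0$ is the Riesz space of eventually constant real sequences with pointwise operations and order. For $n\in\mathbb{N}=\{1,2,\dots\}$, $e_n$ is the sequence with $n$-th term $1$ and all other terms $0$. Spaces of operators carry the operator order: $S\le T$ iff $Sx\le Tx$ for all $x\ge0$. Order convergence: a net $(x_\gamma)_{\gamma\in\Gamma}$ in an Archimedean Riesz space $E$ is order convergent to $x\in E$, written $x_\gamma\xrightarrow{o}x$, if there is a net $(a_\lambda)_{\lambda\in\Lambda}$ in $E$ with $a_\lambda\downarrow0$ (decreasing with infimum $0$) such that for every $\lambda$ there is $\gamma_0$ with $|x_\gamma-x|\le a_\lambda$ for all $\gamma\ge\gamma_0$. A linear operator $T:E\to G$ between Archimedean Riesz spaces is order continuous if $x_\alpha\xrightarrow{o}0$ in $E$ implies $Tx_\alpha\xrightarrow{o}0$ in $G$ for all nets. $\mathcal{L}^n(E,G)$ is the space of order continuous linear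 operators (these are automatically order bounded). A Riesz space $F$ is almost Dedekind $\sigma$-complete if it can be embedded as a super order dense Riesz subspace of a Dedekind $\sigma$-complete Riesz space $G$, i.e. every $y\in G$ is both the supremum of some sequence from $F$ and the infimum of some sequence from $F$. In this case $F^\sigma=G$ (the Dedekind $\sigma$-completion of $F$), so $F^\sigma$ is Dedekind $\sigma$-complete. Sequential order closure: for an Archimedean Riesz space $F$, $F^\sigma$ is the (essentially unique) Archimedean Riesz space $F^\sigma\supseteq F$ such that (1) $F$ is an order dense vector sublattice of $F^\sigma$; (2) any increasing sequence in $F$ with a supremum in $F$ has the same supremum in $F^\sigma$; (3) every increasing sequence in $F$ which is bounded above has a supremum in $F^\sigma$; (4) condition (3) does not hold for any strictly smaller vector sublattice of $F^\sigma$ (containing $F$). A linear subspace $E$ of a partially ordered vector space $G$ is order dense in $G$ if $y=\inf\{x\in E:x\ge y\}$ for every $y\in G$. Every directed (positively generated) Archimedean partially ordered vector space $E$ is a so-called pre-Riesz space. The Riesz completion $E^\rho$ of a pre-Riesz space $E$ is the (essentially unique) Riesz space $G$ for which there is a bipositive linear map $i:E\to G$ (i.e. $x\ge0\iff i(x)\ge0$) with $i(E)$ order dense in $G$ and generating $G$ as a Riesz space. *)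

(* Defs.v *)
From HB Require Import structures.
From mathcomp Require Import all_boot all_order all_algebra.
From mathcomp Require Import all_classical all_reals.

Set Implicit Arguments.
Unset Strict Implicit.
Unset Printing Implicit Defensive.

Import Order.TTheory GRing.Theory Num.Theory.
Local Open Scope classical_set_scope.
Local Open Scope ring_scope.

HB.mixin Record isOrderedLmodule (R : realType) V
    of GRing.Lmodule R V & Order.POrder ring_display V := {
  povs_leD2r : forall z x y : V, x <= y -> x + z <= y + z ;
  povs_scale_ge0 : forall (c : R) (x : V), 0 <= c -> 0 <= x -> 0 <= c *: x
}.

#[short(type="povsType")]
HB.structure Definition Povs (R : realType) :=
  {V of GRing.Lmodule R V & Order.POrder ring_display V & isOrderedLmodule R V}.

(* The join is a field of its own, rather than Order.Lattice, because HB does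
   not accept a new common descendant of GRing.Zmodule and Order.Lattice beside
   realDomainType.  The meet of x and y is - (- x \/ - y). *)
HB.mixin Record isRiesz (R : realType) V of Povs R V := {
  riesz_join : V -> V -> V ;
  riesz_leUx : forall x y z : V,
    (riesz_join x y <= z) = (x <= z) && (y <= z)
}.

#[short(type="rieszType")]
HB.structure Definition Riesz (R : realType) := {V of Povs R V & isRiesz R V}.

Section PovsTheory.
Context {R : realType} {V : povsType R}.
Implicit Types x y z : V.

Lemma povs_subr_ge0 x y : (0 <= y - x) = (x <= y).
Proof.
apply/idP/idP => [/(povs_leD2r x _ _)|/(povs_leD2r (- x) _ _)]; first by rewrite add0r subrK.
by rewrite subrr.
Qed.

Lemma povs_leD x y z t : x <= y -> z <= t -> x + z <= y + t.
Proof.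
move=> xy zt; apply: le_trans (povs_leD2r z _ _ xy) _.
by rewrite ![y + _]addrC povs_leD2r.
Qed.

Lemma povs_leBlDr x y z : (x - y <= z) = (x <= z + y).
Proof. by rewrite -(povs_subr_ge0 (x - y)) -(povs_subr_ge0 x) opprB addrA. Qed.

Lemma povs_leN2 x y : (- x <= - y) = (y <= x).
Proof. by rewrite -(povs_subr_ge0 (- x)) opprK addrC povs_subr_ge0. Qed.

Lemma povs_leZ (c : R) x y : 0 <= c -> x <= y -> c *: x <= c *: y.
Proof.
move=> c0 xy; rewrite -(povs_subr_ge0 (c *: x)) -scalerBr.
by apply: povs_scale_ge0; rewrite // povs_subr_ge0.
Qed.

End PovsTheory.

Section PovsNotions.
Context {R : realType}.

Definition archimedean (E : povsType R) : Prop :=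
  forall x y : E, (forall n : nat, x *+ n.+1 <= y) -> x <= 0.

Definition lattice_ordered (E : povsType R) : Prop :=
  forall x y : E, exists z, supremums [set x; y] z.

Definition order_dense (G : povsType R) (D : set G) : Prop :=
  forall y, infimums [set x | D x /\ y <= x] y.

Definition linear_subspace (G : povsType R) (H : set G) : Prop :=
  H 0 /\ forall (c : R) x y, H x -> H y -> H (c *: x + y).

(* Closure under binary infima follows from linearity. *)
Definition riesz_subspace (G : povsType R) (H : set G) : Prop :=
  linear_subspace H /\
  forall x y z, H x -> H y -> supremums [set x; y] z -> H z.

Definition generates_riesz (G : povsType R) (D : set G) : Prop :=
  forall H : set G, riesz_subspace H -> D `<=` H -> H = setT.

Definition bipositive (E G : povsType R) (i : E -> G) : Prop :=
  forall x, 0 <= x <-> 0 <= i x.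

Definition riesz_completion (E G : povsType R) (i : E -> G) : Prop :=
  [/\ lattice_ordered G, linear i, bipositive i,
      order_dense (range i) & generates_riesz (range i)].

(* [j] identifies E with a Riesz subspace of G, including its order. *)
Definition riesz_embedding (E G : povsType R) (j : E -> G) : Prop :=
  [/\ linear j, bipositive j & riesz_subspace (range j)].

Definition dedekind_sigma_complete (G : povsType R) : Prop :=
  forall u : nat -> G, ubound (range u) !=set0 -> supremums (range u) !=set0.

Definition super_order_dense (F G : povsType R) (j : F -> G) : Prop :=
  forall y : G,
    (exists u : nat -> F, supremums (range (j \o u)) y) /\
    (exists v : nat -> F, infimums (range (j \o v)) y).

Definition almost_dedekind_sigma_complete (F : rieszType R) : Prop :=
  exists (G : rieszType R) (j : F -> G),
    [/\ dedekind_sigma_complete G, riesz_embedding j & super_order_dense j].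

(* Every increasing sequence of F bounded above in H has a supremum in H;
   boundedness and supremum are both relative to H. *)
Definition has_monotone_sups (F Fs : povsType R) (iota : F -> Fs)
    (H : set Fs) : Prop :=
  forall f : nat -> F, {homo f : m n / (m <= n)%N >-> m <= n} ->
  (H `&` ubound (range (iota \o f))) !=set0 ->
  exists2 s, (H `&` ubound (range (iota \o f))) s &
             lbound (H `&` ubound (range (iota \o f))) s.

Definition seq_order_closure (F Fs : rieszType R) (iota : F -> Fs) : Prop :=
  archimedean Fs /\
  [/\ riesz_embedding iota /\ order_dense (range iota),
      forall f : nat -> F, {homo f : m n / (m <= n)%N >-> m <= n} ->
        forall s, supremums (range f) s ->
                  supremums (range (iota \o f)) (iota s),
      has_monotone_sups iota setT
    & forall H : set Fs, riesz_subspace H -> range iota `<=` H ->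
        has_monotone_sups iota H -> H = setT].

End PovsNotions.

Record directedSet := DirectedSet {
  dir_sort :> Type ;
  dir_le : dir_sort -> dir_sort -> Prop ;
  dir_refl : forall i, dir_le i i ;
  dir_trans : forall j i k, dir_le i j -> dir_le j k -> dir_le i k ;
  dir_inhabited : inhabited dir_sort ;
  dir_directed : forall i j, exists k, dir_le i k /\ dir_le j k
}.

Section OrderConvergence.
Context {R : realType}.

Definition riesz_abs (E : rieszType R) (x : E) : E := riesz_join x (- x).

Definition decreases_to0 (E : povsType R) (L : directedSet) (a : L -> E) :=
  (forall i j, dir_le i j -> a j <= a i) /\ infimums (range a) 0.

Definition order_cvg (E : rieszType R) (D : directedSet) (x : D -> E) (l : E) :=
  exists (L : directedSet) (a : L -> E), decreases_to0 a /\
    forall i, exists d0, forall d, dir_le d0 d -> riesz_abs (x d - l) <= a i.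

Definition order_continuous (E G : rieszType R) (T : E -> G) : Prop :=
  forall (D : directedSet) (x : D -> E), order_cvg x 0 -> order_cvg (T \o x) 0.

End OrderConvergence.

Definition prod_directed (I J : directedSet) : directedSet.
Proof.
apply: (@DirectedSet (I * J)%type
  (fun p q => dir_le p.1 q.1 /\ dir_le p.2 q.2)).
- by move=> p; split; apply: dir_refl.
- by move=> q p r [? ?] [? ?]; split; apply: dir_trans; eassumption.
- by case: (dir_inhabited I) (dir_inhabited J) => i [j].
- move=> p q; have [k1 [? ?]] := dir_directed p.1 q.1.
  by have [k2 [? ?]] := dir_directed p.2 q.2; exists (k1, k2).
Defined.

Definition unit_directed : directedSet.
Proof.
by apply: (@DirectedSet unit (fun _ _ => True)) => // *; exists tt.
Defined.

Section OrderContinuousClosed.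
Context {R : realType} {E G : rieszType R}.

Lemma riesz_abs_le (x a : G) : (riesz_abs x <= a) = (x <= a) && (- x <= a).
Proof. by rewrite /riesz_abs riesz_leUx. Qed.

Lemma order_continuous0 : order_continuous (fun _ : E => 0 : G).
Proof.
move=> D x _; exists unit_directed, (fun=> 0); split.
  split=> [//|]; split=> [_ [_ _ <-]//|y ylb]; apply: ylb.
  by exists tt.
move=> _; case: (dir_inhabited D) => d0; exists d0 => d _ /=.
by rewrite riesz_abs_le subr0 oppr0 lexx.
Qed.

Lemma order_continuousD (S T : E -> G) : order_continuous S ->
  order_continuous T -> order_continuous (fun x => S x + T x).
Proof.
move=> Sc Tc D x x0.
have [L [a [[adec [a0 ainf]] aS]]] := Sc D x x0.
have [M [b [[bdec [b0 binf]] bT]]] := Tc D x x0.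
exists (prod_directed L M), (fun p => a p.1 + b p.2); split.
  split; first by move=> p q [/adec ? /bdec ?]; exact: povs_leD.
  split.
    move=> _ [p _ <-]; rewrite -[0 in X in X <= _](addr0 (0 : G)).
    by apply: povs_leD; [apply: a0; exists p.1|apply: b0; exists p.2].
  move=> w wlb; apply: ainf => _ [l _ <-].
  rewrite -[a l]add0r -povs_leBlDr; apply: binf => _ [m _ <-].
  by rewrite povs_leBlDr addrC; apply: wlb; exists (l, m).
move=> [l m]; have [d1 h1] := aS l; have [d2 h2] := bT m.
have [d0 [d10 d20]] := dir_directed d1 d2; exists d0 => d d0d.
have := h1 d (dir_trans d10 d0d); have := h2 d (dir_trans d20 d0d).
rewrite !riesz_abs_le !subr0 /= => /andP[t1 t2] /andP[s1 s2].
by rewrite opprD !povs_leD.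
Qed.

Lemma order_continuousZ (c : R) (T : E -> G) : order_continuous T ->
  order_continuous (fun x => c *: T x).
Proof.
move=> Tc; have [->|c0] := eqVneq c 0.
  have -> : (fun x => 0 *: T x) = (fun=> 0) by apply/funext => x; rewrite scale0r.
  exact: order_continuous0.
have nc0 : 0 < `|c| by rewrite normr_gt0.
move=> D x /Tc[L [a [[adec [a0 ainf]] aT]]].
exists L, (fun l => `|c| *: a l); split.
  split; first by move=> i j /adec ?; exact: povs_leZ.
  split=> [_ [l _ <-]|w wlb].
    by apply: povs_scale_ge0 => //; apply: a0; exists l.
  have : `|c|^-1 *: w <= 0.
    apply: ainf => _ [l _ <-].
    rewrite -[a l](scalerK (lt0r_neq0 nc0)); apply: povs_leZ.
      by rewrite invr_ge0.
    by apply: wlb; exists l.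
  move=> /(povs_leZ (ltW nc0)).
  by rewrite scalerA divff ?lt0r_neq0// scale1r scaler0.
move=> l; have [d0 h] := aT l; exists d0 => d /h.
rewrite !riesz_abs_le !subr0 /= => /andP[t1 t2].
have [cge|clt] := leP 0 c.
  by rewrite (ger0_norm cge) -scalerN !povs_leZ.
have -> : c *: T (x d) = `|c| *: (- T (x d)).
  by rewrite ltr0_norm // scaleNr scalerN opprK.
by rewrite -scalerN opprK !povs_leZ.
Qed.

End OrderContinuousClosed.

Definition oc_linear {R : realType} (E G : rieszType R) : pred (E -> G) :=
  fun T => `[< linear T /\ order_continuous T >].

Record Ln {R : realType} (E G : rieszType R) := MkLn {
  Ln_fun :> E -> G ;
  Ln_prop : Ln_fun \in @oc_linear R E G
}.

Section LnPovs.
Context {R : realType} {E G : rieszType R}.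

HB.instance Definition _ := [isSub for @Ln_fun R E G].
HB.instance Definition _ := [Choice of Ln E G by <:].

Fact oc_linear_submod : submod_closed (@oc_linear R E G).
Proof.
split.
  apply/asboolP; split; last exact: order_continuous0.
  by move=> c x y /=; rewrite scaler0 addr0.
move=> c S T /asboolP[Sl Sc] /asboolP[Tl Tc]; apply/asboolP; split.
  move=> k x y.
  change (c *: S (k *: x + y) + T (k *: x + y) =
          k *: (c *: S x + T x) + (c *: S y + T y)).
  by rewrite Sl Tl !scalerDr !scalerA (mulrC k) addrACA.
exact: (order_continuousD (order_continuousZ c Sc) Tc).
Qed.

HB.instance Definition _ :=
  GRing.isSubmodClosed.Build R (E -> G) (@oc_linear R E G) oc_linear_submod.
HB.instance Definition _ := [SubChoice_isSubLmodule of Ln E G by <:].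

Lemma Ln_linear (T : Ln E G) : linear T.
Proof. by case: T => T /= /asboolP[]. Qed.

Definition Ln_le (S T : Ln E G) : bool :=
  `[< forall x : E, 0 <= x -> S x <= T x >].

Fact Ln_le_refl : reflexive Ln_le.
Proof. by move=> T; apply/asboolP. Qed.

Fact Ln_le_trans : transitive Ln_le.
Proof.
move=> T S U /asboolP ST /asboolP TU; apply/asboolP => x x0.
exact: le_trans (ST x x0) (TU x x0).
Qed.

Fact Ln_le_anti : antisymmetric Ln_le.
Proof.
move=> S T /andP[/asboolP ST /asboolP TS].
have eq_pos x : 0 <= x -> S x = T x.
  by move=> x0; apply/le_anti; rewrite ST // TS.
apply/val_inj/funext => x /=.
pose p : E := riesz_join x 0.
have /andP[xp p0] : (x <= p) && (0 <= p) by rewrite -riesz_leUx.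
have px : 0 <= p - x by rewrite povs_subr_ge0.
have -> : x = (- 1) *: (p - x) + p by rewrite scaleN1r opprB subrK.
by rewrite !Ln_linear !eq_pos.
Qed.

HB.instance Definition _ := Order.Le_isPOrder.Build ring_display (Ln E G)
  Ln_le_refl Ln_le_anti Ln_le_trans.

Fact Ln_leD2r (U S T : Ln E G) : S <= T -> S + U <= T + U.
Proof.
move=> /asboolP ST; apply/asboolP => x x0.
exact: povs_leD2r _ _ _ (ST x x0).
Qed.

Fact Ln_scale_ge0 (c : R) (T : Ln E G) : 0 <= c -> 0 <= T -> 0 <= c *: T.
Proof.
move=> c0 /asboolP T0; apply/asboolP => x x0.
exact: povs_scale_ge0 _ _ c0 (T0 x x0).
Qed.

HB.instance Definition _ := isOrderedLmodule.Build R (Ln E G)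
  Ln_leD2r Ln_scale_ge0.

End LnPovs.

Definition ev_const {R : realType} : pred (nat -> R) :=
  fun x => `[< exists (N : nat) (c : R), forall n, (N <= n)%N -> x n = c >].

Record linf0 (R : realType) := MkLinf0 {
  linf0_seq :> nat -> R ;
  linf0_prop : linf0_seq \in @ev_const R
}.

Section Linf0.
Context {R : realType}.

HB.instance Definition _ := [isSub for @linf0_seq R].
HB.instance Definition _ := [Choice of linf0 R by <:].

Lemma ev_const2 (op : R -> R -> R) (x y : nat -> R) :
  x \in ev_const -> y \in ev_const -> (fun n => op (x n) (y n)) \in ev_const.
Proof.
move=> /asboolP[N [c xc]] /asboolP[M [d yd]]; apply/asboolP.
exists (maxn N M), (op c d) => n; rewrite geq_max => /andP[Nn Mn].
by rewrite xc // yd.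
Qed.

Fact ev_const_zmod : zmod_closed (@ev_const R).
Proof.
split; first by apply/asboolP; exists 0%N, 0.
move=> x y xe ye; exact: (ev_const2 (fun a b => a - b) xe ye).
Qed.

HB.instance Definition _ :=
  GRing.isZmodClosed.Build (nat -> R) (@ev_const R) ev_const_zmod.
HB.instance Definition _ := [SubChoice_isSubZmodule of linf0 R by <:].

Definition linf0_scale (c : R) (x : linf0 R) : linf0 R :=
  MkLinf0 (ev_const2 (fun a _ => c * a) (linf0_prop x) (linf0_prop x)).

Fact linf0_scaleA (c d : R) (x : linf0 R) :
  linf0_scale c (linf0_scale d x) = linf0_scale (c * d) x.
Proof. by apply/val_inj/funext => n /=; rewrite mulrA. Qed.

Fact linf0_scale1 : left_id 1 linf0_scale.
Proof. by move=> x; apply/val_inj/funext => n /=; rewrite mul1r. Qed.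

Fact linf0_scaleDr : right_distributive linf0_scale +%R.
Proof. by move=> c x y; apply/val_inj/funext => n; exact: mulrDr. Qed.

Fact linf0_scaleDl (x : linf0 R) :
  {morph linf0_scale^~ x : c d / c + d}.
Proof. by move=> c d; apply/val_inj/funext => n; exact: mulrDl. Qed.

HB.instance Definition _ := GRing.Zmodule_isLmodule.Build R (linf0 R)
  linf0_scaleA linf0_scale1 linf0_scaleDr linf0_scaleDl.
HB.instance Definition _ :=
  [SubChoice_isSubPOrder of linf0 R by <: with ring_display].

Lemma linf0_leP (x y : linf0 R) : reflect (forall n, x n <= y n) (x <= y).
Proof. by rewrite -Order.le_val; exact: lefP. Qed.

Fact linf0_leD2r (z x y : linf0 R) : x <= y -> x + z <= y + z.
Proof. by move=> /linf0_leP xy; apply/linf0_leP => n; exact: lerD (xy n) (lexx _). Qed.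

Fact linf0_scale_ge0 (c : R) (x : linf0 R) : 0 <= c -> 0 <= x -> 0 <= c *: x.
Proof. by move=> c0 /linf0_leP x0; apply/linf0_leP => n; exact: mulr_ge0 c0 (x0 n). Qed.

HB.instance Definition _ := isOrderedLmodule.Build R (linf0 R)
  linf0_leD2r linf0_scale_ge0.

Definition linf0_join (x y : linf0 R) : linf0 R :=
  MkLinf0 (ev_const2 Num.max (linf0_prop x) (linf0_prop y)).

Fact linf0_leUx (x y z : linf0 R) :
  (linf0_join x y <= z) = (x <= z) && (y <= z).
Proof.
apply/linf0_leP/andP => [xyz|[/linf0_leP xz /linf0_leP yz] n /=].
  by split; apply/linf0_leP => n; have := xyz n; rewrite /= ge_max => /andP[].
by rewrite ge_max xz yz.
Qed.

HB.instance Definition _ := isRiesz.Build R (linf0 R) linf0_leUx.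

Fact unit_seq_ev_const (n : nat) : (fun k : nat => (k == n)%:R) \in @ev_const R.
Proof.
by apply/asboolP; exists n.+1, 0 => k nk; rewrite gtn_eqF.
Qed.

(* Sequences are indexed from 0 here: [unit_seq n] is e_(n+1). *)
Definition unit_seq (n : nat) : linf0 R := MkLinf0 (unit_seq_ev_const n).

End Linf0.

Definition unit_values_in {R : realType} (F Fs : rieszType R)
    (iota : {linear F -> Fs}) : pred (Ln (linf0 R) Fs) :=
  fun T => `[< forall n, range iota (T (unit_seq n)) >].

Record Hn {R : realType} (F Fs : rieszType R) (iota : {linear F -> Fs}) := MkHn {
  Hn_op :> Ln (linf0 R) Fs ;
  Hn_prop : Hn_op \in unit_values_in iota
}.

Section HnPovs.
Context {R : realType} {F Fs : rieszType R} {iota : {linear F -> Fs}}.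

HB.instance Definition _ := [isSub for @Hn_op R F Fs iota].
HB.instance Definition _ := [Choice of Hn iota by <:].

Fact unit_values_in_submod : submod_closed (unit_values_in iota).
Proof.
split; first by apply/asboolP => n; exists 0; rewrite ?linear0.
move=> c S T /asboolP Si /asboolP Ti; apply/asboolP => n.
have [x _ xE] := Si n; have [y _ yE] := Ti n.
by exists (c *: x + y); rewrite // linearP xE yE.
Qed.

HB.instance Definition _ := GRing.isSubmodClosed.Build R (Ln (linf0 R) Fs)
  (unit_values_in iota) unit_values_in_submod.
HB.instance Definition _ := [SubChoice_isSubLmodule of Hn iota by <:].
HB.instance Definition _ := [SubChoice_isSubPOrder of Hn iota by <: with ring_display].

Fact Hn_leD2r (U S T : Hn iota) : S <= T -> S + U <= T + U.
Proof. by rewrite -!Order.le_val; exact: povs_leD2r. Qed.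

Fact Hn_scale_ge0 (c : R) (T : Hn iota) : 0 <= c -> 0 <= T -> 0 <= c *: T.
Proof. by rewrite -!Order.le_val; exact: povs_scale_ge0. Qed.

HB.instance Definition _ := isOrderedLmodule.Build R (Hn iota)
  Hn_leD2r Hn_scale_ge0.

End HnPovs.

(* Main.v *)
From HB Require Import structures.
Require Import Defs.
From mathcomp Require Import all_boot all_order all_algebra.
From mathcomp Require Import all_classical all_reals.
Local Open Scope ring_scope.

(** An operator on the eventually constant sequences is a sequence of values
    t_k at the unit sequences together with a value t at the constant sequence
    1, and for an order continuous operator t is the order limit of the partial
    sums of the t_k.  The proof describes the operators into F^sigma by the
    sequences (t_k) alone.

    - The order is coordinatewise ([Ln_le_unit]): a positive sequence is the
      order limit of its truncations, whose images are positive combinations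
      of the t_k.
    - An order continuous operator is bounded on [0, 1] ([Ln_bounded]), so that
      the sums of the positive parts of the t_k are bounded
      ([Ln_sum_pos_bounded]).  Conversely, a positive sequence whose partial
      sums have a supremum s defines an order continuous operator with value s
      at 1 ([series_op_Ln]).  In F^sigma bounded increasing sequences of F have
      suprema.  Hence suprema in H_n exist and are computed coordinatewise
      ([Hn_sup]).
    - Since F is order dense in F^sigma, a net of F is order convergent in F if
      and only if it is so in F^sigma.  Therefore L^n(l_0^oo, F) consists of the
      T in H_n with T 1 in F ([incl_range]), and everything else takes place
      inside H_n, where the only constraint to be met is on the value at 1.

    Order density.  Given y in H_n, the element y 1 of F^sigma is the infimum of
    a decreasing sequence g of F; here F has to be almost Dedekind
    sigma-complete ([closure_inf_seq]).  Adding to y_k the terms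
    g_k - g_(k+1) raises the value at 1 from y 1 to g_0.  Starting
    this correction late leaves any prescribed coordinate untouched, so y
    is the infimum of such majorants ([incl_majorant]).

    Generation.  It is enough to obtain the positive y in H_n.  Let Y keep the
    coordinates of y with even index and let Z be Y shifted by one place.  Then
    Y and Z are disjoint and have the same sum, so Y - Z vanishes at 1,
    belongs to L^n(l_0^oo, F), and has Y as its positive part ([Hn_parity]).
    The coordinates with odd index are treated alike, and y is the sum of the
    two parts. *)

Set Implicit Arguments.
Unset Strict Implicit.
Unset Printing Implicit Defensive.

Import Order.TTheory GRing.Theory Num.Theory.
Local Open Scope classical_set_scope.

(** * Ordered vector spaces and Riesz spaces *)

Section OrderedSpaces.
Context {R : realType}.

Lemma povs_leBrDr (V : povsType R) (x y z : V) : (x <= y - z) = (x + z <= y).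
Proof. by rewrite -(povs_subr_ge0 x) -(povs_subr_ge0 (x + z)) opprD addrAC addrA. Qed.

Lemma povs_leDl (V : povsType R) (x y : V) : (x <= x + y) = (0 <= y).
Proof. by rewrite -(povs_subr_ge0 x) addrC addKr. Qed.

Lemma povs_oppr_le0 (V : povsType R) (x : V) : (- x <= 0) = (0 <= x).
Proof. by rewrite -{1}oppr0 povs_leN2. Qed.

Lemma povs_sum_ge0 (V : povsType R) (I : Type) (r : seq I) (P : pred I) (f : I -> V) :
  (forall i, P i -> 0 <= f i) -> 0 <= \sum_(i <- r | P i) f i.
Proof.
move=> f0; apply: (big_ind (fun x : V => 0 <= x)) => // x y x0 y0.
by rewrite -[0 in X in X <= _](addr0 (0 : V)); apply: povs_leD.
Qed.

Lemma povs_le_sum (V : povsType R) (I : Type) (r : seq I) (P : pred I) (f g : I -> V) :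
  (forall i, P i -> f i <= g i) -> \sum_(i <- r | P i) f i <= \sum_(i <- r | P i) g i.
Proof.
move=> fg; rewrite -povs_subr_ge0 -sumrB; apply: povs_sum_ge0 => i Pi.
by rewrite povs_subr_ge0 fg.
Qed.

Lemma povs_scaler_leZ (V : povsType R) (c d : R) (x : V) :
  c <= d -> 0 <= x -> c *: x <= d *: x.
Proof.
move=> cd x0; rewrite -povs_subr_ge0 -scalerBl.
by apply: povs_scale_ge0; rewrite // subr_ge0.
Qed.

Lemma povs_le0Z (V : povsType R) (c : R) (x : V) : 0 < c -> c *: x <= 0 -> x <= 0.
Proof.
move=> c0 cx; rewrite -(scalerK (lt0r_neq0 c0) x) -[0](scaler0 V c^-1).
by apply: povs_leZ; rewrite // invr_ge0 ltW.
Qed.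

Lemma riesz_joinl (V : rieszType R) (x y : V) : x <= riesz_join x y.
Proof. by have := lexx (riesz_join x y); rewrite riesz_leUx => /andP[]. Qed.

Lemma riesz_joinr (V : rieszType R) (x y : V) : y <= riesz_join x y.
Proof. by have := lexx (riesz_join x y); rewrite riesz_leUx => /andP[]. Qed.

Lemma riesz_join_le (V : rieszType R) (x y z : V) :
  x <= z -> y <= z -> riesz_join x y <= z.
Proof. by move=> xz yz; rewrite riesz_leUx xz. Qed.

Lemma riesz_joinP (V : rieszType R) (x y : V) : supremums [set x; y] (riesz_join x y).
Proof.
split=> [z [->|->]|u ub]; first exact: riesz_joinl; first exact: riesz_joinr.
by apply: riesz_join_le; apply: ub; [left|right].
Qed.

Lemma supremums_unique (V : povsType R) (A : set V) (x y : V) :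
  supremums A x -> supremums A y -> x = y.
Proof. by move=> [xu xl] [yu yl]; apply/le_anti; rewrite xl // yl. Qed.

End OrderedSpaces.

(** * Squeezing elements between sequences *)

Section Squeeze.
Context {R : realType}.

Definition vanishing (V : povsType R) (d : nat -> V) : Prop :=
  {homo d : m n / (m <= n)%N >-> n <= m} /\
  forall w, (forall n, w <= d n) -> w <= 0.

Lemma vanishingD (V : povsType R) (c d : nat -> V) :
  vanishing c -> vanishing d -> vanishing (fun n => c n + d n).
Proof.
move=> [cm c0] [dm d0]; split=> [m n mn|w wlb]; first by apply: povs_leD; auto.
apply: d0 => m; rewrite -[d m]add0r -povs_leBlDr; apply: c0 => n.
rewrite povs_leBlDr; apply: le_trans (wlb (maxn n m)) _.
by apply: povs_leD; [apply: cm; apply: leq_maxl|apply: dm; apply: leq_maxr].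
Qed.

Lemma vanishingZ (V : povsType R) (c : R) (d : nat -> V) :
  0 < c -> vanishing d -> vanishing (fun n => c *: d n).
Proof.
move=> c0 [dm d0]; split=> [m n mn|w wlb].
  by apply: povs_leZ; [exact: ltW|exact: dm].
have ci0 : 0 < c^-1 by rewrite invr_gt0.
apply: (povs_le0Z ci0); apply: d0 => n.
by rewrite -[d n](scalerK (lt0r_neq0 c0)) povs_leZ ?wlb // ltW.
Qed.

Lemma vanishing_le (V : povsType R) (c d : nat -> V) :
  {homo d : m n / (m <= n)%N >-> n <= m} ->
  (forall n, d n <= c n) -> vanishing c -> vanishing d.
Proof.
by move=> dm dc [_ c0]; split=> // w wd; apply: c0 => n; apply: le_trans (wd n) (dc n).
Qed.

End Squeeze.

Section Closure.
Context {R : realType} {F Fs : rieszType R} {iota : {linear F -> Fs}}.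

Lemma embN (x : F) : iota (- x) = - iota x. Proof. exact: raddfN. Qed.

Lemma embB (x y : F) : iota (x - y) = iota x - iota y. Proof. exact: raddfB. Qed.

Section Embedding.
Context (emb : riesz_embedding iota).

Lemma emb_ge0 (x : F) : (0 <= iota x) = (0 <= x).
Proof. by have [_ bip _] := emb; apply/idP/idP; apply bip. Qed.

Lemma emb_le (x y : F) : (iota x <= iota y) = (x <= y).
Proof. by rewrite -povs_subr_ge0 -embB emb_ge0 povs_subr_ge0. Qed.

Lemma emb_inj : injective iota.
Proof. by move=> x y xy; apply/le_anti; rewrite -!emb_le xy lexx. Qed.

(** A Riesz subspace is closed under the joins of the larger space, so the join
    formed there is the image of some z, which is then an upper bound in F. *)
Lemma emb_join (x y : F) : iota (riesz_join x y) = riesz_join (iota x) (iota y).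
Proof.
have [_ _ [_ sub]] := emb; apply/le_anti/andP; split; last first.
  by apply: riesz_join_le; rewrite emb_le ?riesz_joinl ?riesz_joinr.
have rg a : range iota (iota a) by exists a.
have [z _ zE] := sub _ _ _ (rg x) (rg y) (riesz_joinP (iota x) (iota y)).
by rewrite -zE emb_le; apply: riesz_join_le; rewrite -emb_le zE ?riesz_joinl ?riesz_joinr.
Qed.

(** This is the candidate for the subspace in the minimality condition of the
    sequential order closure.  The gap between the two sequences is required to
    vanish in F rather than in the larger space, so that the condition can be
    checked in any Dedekind sigma-complete extension of F. *)
Definition squeezed (y : Fs) : Prop :=
  exists f g : nat -> F,
    [/\ {homo f : m n / (m <= n)%N >-> m <= n},
        {homo g : m n / (m <= n)%N >-> n <= m},
        forall n, iota (f n) <= y <= iota (g n)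
      & vanishing (fun n => g n - f n)].

Lemma squeezed_iota (x : F) : squeezed (iota x).
Proof.
exists (fun=> x), (fun=> x); split=> // [n|]; first by rewrite lexx.
by rewrite subrr; split=> // w /(_ 0%N).
Qed.

Lemma squeezedD (x y : Fs) : squeezed x -> squeezed y -> squeezed (x + y).
Proof.
move=> [f [g [fm gm fxg v]]] [f' [g' [fm' gm' fyg v']]].
exists (fun n => f n + f' n), (fun n => g n + g' n); split.
- by move=> m n mn; apply: povs_leD; [apply: fm|apply: fm'].
- by move=> m n mn; apply: povs_leD; [apply: gm|apply: gm'].
- move=> n; have /andP[? ?] := fxg n; have /andP[? ?] := fyg n.
  by rewrite !raddfD !povs_leD.
- under eq_fun do rewrite opprD addrACA.
  exact: vanishingD.
Qed.

Lemma squeezedN (x : Fs) : squeezed x -> squeezed (- x).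
Proof.
move=> [f [g [fm gm fxg v]]]; exists (fun n => - g n), (fun n => - f n); split.
- by move=> m n mn; rewrite povs_leN2 gm.
- by move=> m n mn; rewrite povs_leN2 fm.
- by move=> n; have /andP[? ?] := fxg n; rewrite !embN !povs_leN2; apply/andP.
- by under eq_fun do rewrite opprK addrC.
Qed.

Lemma squeezedZ (c : R) (x : Fs) : squeezed x -> squeezed (c *: x).
Proof.
wlog c0 : c / 0 < c => [hw sx|].
  have [c0|c0|<-] := ltgtP 0 c; first exact: hw.
    by rewrite -[c]opprK scaleNr; apply: squeezedN; apply: hw; rewrite // oppr_gt0.
  by rewrite scale0r -(raddf0 iota); exact: squeezed_iota.
move=> [f [g [fm gm fxg v]]].
have cge0 := ltW c0.
exists (fun n => c *: f n), (fun n => c *: g n); split.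
- by move=> m n mn; apply: povs_leZ; [|apply: fm].
- by move=> m n mn; apply: povs_leZ; [|apply: gm].
- by move=> n; have /andP[? ?] := fxg n; rewrite !linearZ /= !povs_leZ.
- under eq_fun do rewrite -scalerBr.
  exact: vanishingZ.
Qed.

(** The gap between the joins of the bounds is at most the sum of the two gaps. *)
Lemma squeezed_join (x y : Fs) : squeezed x -> squeezed y -> squeezed (riesz_join x y).
Proof.
move=> [f [g [fm gm fxg v]]] [f' [g' [fm' gm' fyg v']]].
have jm (a b c d : F) : a <= c -> b <= d -> riesz_join a b <= riesz_join c d.
  move=> ac bd; apply: riesz_join_le.
    exact: le_trans ac (riesz_joinl _ _).
  exact: le_trans bd (riesz_joinr _ _).
have jfm : {homo (fun n => riesz_join (f n) (f' n)) : m n / (m <= n)%N >-> m <= n}.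
  by move=> m n mn; apply: jm; [apply: fm|apply: fm'].
have jgm : {homo (fun n => riesz_join (g n) (g' n)) : m n / (m <= n)%N >-> n <= m}.
  by move=> m n mn; apply: jm; [apply: gm|apply: gm'].
exists (fun n => riesz_join (f n) (f' n)), (fun n => riesz_join (g n) (g' n)).
split=> // [n|].
  have /andP[fx xg] := fxg n; have /andP[fy yg] := fyg n.
  rewrite !emb_join; apply/andP; split; apply: riesz_join_le.
  - exact: le_trans fx (riesz_joinl _ _).
  - exact: le_trans fy (riesz_joinr _ _).
  - exact: le_trans xg (riesz_joinl _ _).
  - exact: le_trans yg (riesz_joinr _ _).
apply: vanishing_le (vanishingD v v') => [m n mn|n].
  by apply: povs_leD; [apply: jgm|rewrite povs_leN2; apply: jfm].
have fg : f n <= g n by rewrite -emb_le; have /andP[? /(le_trans _)->] := fxg n.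
have fg' : f' n <= g' n by rewrite -emb_le; have /andP[? /(le_trans _)->] := fyg n.
have aux (a b d J : F) : b <= a -> 0 <= d -> b <= J -> a <= a - b + d + J.
  move=> ba d0 bJ; rewrite -addrA -addrA povs_leDl addrCA.
  by rewrite -[0 in X in X <= _](addr0 (0 : F)) addrC povs_leD // addrC povs_subr_ge0.
rewrite povs_leBlDr; apply: riesz_join_le; last rewrite [X in _ <= X + _]addrC.
  by apply: aux; rewrite ?povs_subr_ge0 ?riesz_joinl.
by apply: aux; rewrite ?povs_subr_ge0 ?riesz_joinr.
Qed.

Lemma squeezed_riesz : riesz_subspace squeezed.
Proof.
split; first split.
- by rewrite -(raddf0 iota); exact: squeezed_iota.
- by move=> c x y sx sy; apply: squeezedD => //; apply: squeezedZ.
- move=> x y z sx sy /(supremums_unique (riesz_joinP x y)) <-.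
  exact: squeezed_join.
Qed.

Fixpoint running_meet (v : nat -> F) (n : nat) : F :=
  if n is m.+1 then - riesz_join (- running_meet v m) (- v m.+1) else v 0%N.

Lemma running_meetP (v : nat -> F) (n : nat) (x : F) :
  (x <= running_meet v n) <-> (forall k, (k <= n)%N -> x <= v k).
Proof.
elim: n => [|n IH] /=.
  by split=> [? k|->//]; rewrite leqn0 => /eqP->.
rewrite -{1}[x]opprK povs_leN2 riesz_leUx !povs_leN2; split.
  move=> /andP[/IH xv xn] k; rewrite leq_eqVlt ltnS => /predU1P[->//|]; exact: xv.
by move=> xv; rewrite xv // andbT; apply/IH => k kn; apply/xv/leqW.
Qed.

(** The supremum [t] of [f] taken in the Dedekind sigma-complete space is an
    infimum of a sequence of F, and the gap between the two sequences vanishes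
    already in F, so that no comparison of the two ambient spaces is needed. *)
Lemma bounded_seq_squeeze (f : nat -> F) (u : F) :
  almost_dedekind_sigma_complete F -> (forall n, f n <= u) ->
  {homo f : m n / (m <= n)%N >-> m <= n} ->
  exists2 g : nat -> F, {homo g : m n / (m <= n)%N >-> n <= m} &
    (forall m n, f m <= g n) /\ vanishing (fun n => g n - f n).
Proof.
move=> [G [j [Gc [jl jb _] jd]]] fu fm.
have jB x y : j (x - y) = j x - j y by rewrite addrC -scaleN1r jl scaleN1r addrC.
have jle x y : (j x <= j y) = (x <= y).
  by rewrite -povs_subr_ge0 -jB -(povs_subr_ge0 x); apply/idP/idP => /jb.
have [|t [tu tl]] := Gc (j \o f).
  by exists (j u) => _ [n _ <-] /=; rewrite jle.
have [_ [v [vl vg]]] := jd t.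
have fg m n : f m <= running_meet v n.
  apply/running_meetP => k _; rewrite -jle; apply: (@le_trans _ _ t).
    by apply: tu; exists m.
  by apply: vl; exists k.
have gm : {homo running_meet v : m n / (m <= n)%N >-> n <= m}.
  move=> m n mn; apply/running_meetP => k km.
  by move: (lexx (running_meet v n)) => /running_meetP; apply; exact: leq_trans km mn.
exists (running_meet v) => //; split=> //; split=> [m n mn|w wlb].
  by apply: povs_leD; rewrite ?povs_leN2; [apply: gm|apply: fm].
rewrite -jle -(subrr 0) jB subrr -(subrr t) povs_leBrDr addrC -povs_leBrDr.
apply: tl => _ [m _ <-] /=; rewrite povs_leBrDr; apply: vg => _ [n _ <-] /=.
rewrite addrC -povs_leBrDr -jB jle.
apply: le_trans (wlb (maxn m n)) _; apply: povs_leD.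
  by move: (lexx (running_meet v (maxn m n))) => /running_meetP; apply; exact: leq_maxr.
by rewrite povs_leN2; apply: fm; exact: leq_maxl.
Qed.

End Embedding.
End Closure.

(** * The sequential order closure *)

Section SequentialClosure.
Context {R : realType} {F Fs : rieszType R} {iota : {linear F -> Fs}}.
Context (clo : seq_order_closure iota).

Let emb : riesz_embedding iota.
Proof. by have [_ [[]]] := clo. Qed.

Lemma closure_sup (f : nat -> F) (b : Fs) :
  {homo f : m n / (m <= n)%N >-> m <= n} -> (forall n, iota (f n) <= b) ->
  exists s, supremums (range (iota \o f)) s.
Proof.
move=> fm fb; have [_ [_ _ mono _]] := clo.
have [|s [_ su] sl] := mono f fm.
  by exists b; split=> // _ [n _ <-]; exact: fb.
by exists s; split=> // u uu; apply: sl.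
Qed.

(** The squeezed elements form a Riesz subspace containing F.  It also has the
    monotone suprema: an increasing sequence of F below a squeezed element is
    bounded in F, and [bounded_seq_squeeze] then gives the upper bounds for its
    supremum.  By minimality this subspace is everything. *)
Lemma closure_squeezed : almost_dedekind_sigma_complete F ->
  forall y, squeezed (iota := iota) y.
Proof.
move=> sig y; have [_ [_ _ mono min]] := clo.
suff -> : squeezed (iota := iota) = setT by [].
apply: min; first exact: squeezed_riesz.
  by move=> _ [x _ <-]; exact: squeezed_iota.
move=> f fm [b [[f' [g [_ _ bg _]]] bu]].
have fg n : f n <= g 0%N.
  rewrite -(emb_le emb); have /andP[_] := bg 0%N; apply: le_trans.
  by apply: bu; exists n.
have [h hm [fh v]] := bounded_seq_squeeze sig fg fm.
have [|s [su sl]] := closure_sup fm (b := b).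
  by move=> n; apply: bu; exists n.
exists s; last by move=> z [_ zu]; exact: sl.
split=> //; exists f, h; split=> // n; apply/andP; split.
  by apply: su; exists n.
by apply: sl => _ [m _ <-] /=; rewrite (emb_le emb).
Qed.

(** The gap f_n - g_n increases to 0 in F, and suprema of increasing sequences
    of F persist in the closure; a lower bound w of g satisfies
    f_n - g_n <= y - w for all n. *)
Lemma closure_inf_seq : almost_dedekind_sigma_complete F -> forall y : Fs,
  exists2 g : nat -> F, {homo g : m n / (m <= n)%N >-> n <= m} &
    infimums (range (iota \o g)) y.
Proof.
move=> sig y; have [f [g [fm gm yfg [vm v0]]]] := closure_squeezed sig y.
exists g => //; split=> [_ [n _ <-]|w wlb]; first by have /andP[] := yfg n.
have [_ [_ supp _ _]] := clo.
have [||_] := supp (fun n => f n - g n) _ 0.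
- by move=> m n /vm; rewrite -povs_leN2 !opprB.
- split=> [_ [n _ <-]|u uu].
    rewrite -povs_leN2 oppr0 opprB povs_subr_ge0 -(emb_le emb).
    by have /andP[/le_trans + ?] := yfg n; apply.
  rewrite -povs_oppr_le0; apply: v0 => n.
  by rewrite -povs_leN2 opprK opprB; apply: uu; exists n.
rewrite raddf0 => /(_ (y - w)); rewrite povs_subr_ge0; apply=> _ [n _ <-] /=.
rewrite embB; apply: povs_leD; first by have /andP[] := yfg n.
by rewrite povs_leN2; apply: wlb; exists n.
Qed.

(** Order density of F applied to the opposites: y is the supremum of the
    elements of F under it. *)
Lemma closure_le (y z : Fs) :
  (forall x : F, iota x <= y -> iota x <= z) -> y <= z.
Proof.
have [_ [[_ dense] _ _ _]] := clo; have [_ dl] := dense (- y).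
move=> yz; rewrite -povs_leN2; apply: dl => _ [[x _ <-] yx].
by rewrite -povs_leN2 opprK -embN; apply: yz; rewrite embN -povs_leN2 opprK.
Qed.

(** A lower bound of the image net dominates only elements of F that are lower
    bounds of the net itself, hence are at most 0. *)
Lemma closure_decreases (L : directedSet) (a : L -> F) :
  decreases_to0 a -> decreases_to0 (iota \o a).
Proof.
move=> [am [a0 al]]; split=> [i j ij /=|]; first by rewrite (emb_le emb) ?am.
split=> [_ [i _ <-] /=|w wlb].
  by rewrite (emb_ge0 emb); apply: a0; exists i.
apply: closure_le => x xw; rewrite -(raddf0 iota) (emb_le emb); apply: al => _ [i _ <-].
by rewrite -(emb_le emb); apply: le_trans xw _; apply: wlb; exists i.
Qed.

(** The elements of F above some term of [a], ordered downwards, form a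
    directed family: the meet of two of them is again above a term. *)
Lemma closure_dominates (L : directedSet) (a : L -> Fs) : decreases_to0 a ->
  exists (M : directedSet) (b : M -> F),
    decreases_to0 b /\ forall m, exists i, a i <= iota (b m).
Proof.
move=> [am [a0 al]]; have [_ [[_ dense] _ _ _]] := clo.
pose T := {p : F * L | a p.2 <= iota p.1}.
pose b (p : T) := (sval p).1.
have Tinh : inhabited T.
  have [i] := dir_inhabited L; have [_ dl] := dense (a i).
  have [x xi] : exists x, a i <= iota x.
    apply: contrapT => nx; have : a i + a i <= a i.
      by apply: dl => _ [[x _ <-] ix]; case: nx; exists x.
    rewrite -povs_leBrDr subrr => ai; case: nx; exists 0.
    by rewrite raddf0.
  by constructor; exists (x, i).
have Tdir (p q : T) : exists r : T, b r <= b p /\ b r <= b q.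
  case: p q => [[x i] /= xi] [[y j] /= yj]; have [k [ik jk]] := dir_directed i j.
  have km : a k <= iota (- riesz_join (- x) (- y)).
    rewrite embN -[a k]opprK povs_leN2 (emb_join emb) !embN.
    by apply: riesz_join_le; rewrite povs_leN2;
       [apply: le_trans (am _ _ ik) xi|apply: le_trans (am _ _ jk) yj].
  exists (exist _ (_, k) km); rewrite /b /= -(povs_leN2 x) -(povs_leN2 y) opprK.
  by rewrite riesz_joinl riesz_joinr.
pose M := @DirectedSet T (fun p q => b q <= b p) (fun p => lexx _)
  (fun _ _ _ pq qr => le_trans qr pq) Tinh Tdir.
exists M, b; split; last by move=> [[x i] xi]; exists i.
split=> //; split=> [_ [[[x i] /= xi] _ <-]|w wlb].
  by rewrite -(emb_ge0 emb); apply: le_trans xi; apply: a0; exists i.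
rewrite -(emb_le emb) raddf0; apply: al => _ [i _ <-]; have [_ dl] := dense (a i).
apply: dl => _ [[x _ <-] ix]; rewrite (emb_le emb); apply: wlb.
by exists (exist _ (x, i) ix).
Qed.

Lemma emb_order_cvg (D : directedSet) (x : D -> F) (l : F) :
  order_cvg x l -> order_cvg (iota \o x) (iota l).
Proof.
move=> [L [a [/closure_decreases ad ax]]]; exists L, (iota \o a); split=> // i.
have [d0 xd] := ax i; exists d0 => d /xd.
by rewrite !riesz_abs_le /= -embB -embN !(emb_le emb).
Qed.

Lemma emb_order_cvg_reflect (D : directedSet) (x : D -> F) (l : F) :
  order_cvg (iota \o x) (iota l) -> order_cvg x l.
Proof.
move=> [L [a [/closure_dominates [M [b [bd ba]]] ax]]]; exists M, b; split=> // m.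
have [i aib] := ba m; have [d0 xd] := ax i; exists d0 => d /xd xa.
have := le_trans xa aib.
by rewrite !riesz_abs_le /= -embB -embN !(emb_le emb).
Qed.

End SequentialClosure.

(** * Eventually constant sequences *)

Section Linf0.
Context {R : realType}.
Implicit Types (x y : linf0 R) (c : R) (k n N : nat).

Lemma linf0D x y n : (x + y) n = x n + y n. Proof. by []. Qed.
Lemma linf0N x n : (- x) n = - x n. Proof. by []. Qed.
Lemma linf0Z c x n : (c *: x) n = c * x n. Proof. by []. Qed.

Lemma linf0_sum (I : Type) (r : seq I) (P : pred I) (f : I -> linf0 R) n :
  (\sum_(i <- r | P i) f i) n = \sum_(i <- r | P i) f i n.
Proof. by elim/big_ind2: _ => // x a y b <- <-. Qed.

Lemma linf0_eq x y : (forall n, x n = y n) -> x = y.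
Proof. by move=> xy; apply/val_inj/funext. Qed.

Fact one_ev_const : (fun=> 1) \in @ev_const R.
Proof. by apply/asboolP; exists 0%N, 1. Qed.

Definition one_seq : linf0 R := MkLinf0 one_ev_const.

Definition truncate N x : linf0 R := \sum_(k < N) x k *: unit_seq k.

Lemma truncateE N x n : truncate N x n = if (n < N)%N then x n else 0.
Proof.
rewrite linf0_sum; have termE k : (x k *: unit_seq k) n = if k == n then x n else 0.
  by rewrite linf0Z /= eq_sym; case: eqP => [->|_]; rewrite ?mulr1 ?mulr0.
under eq_bigr do rewrite termE.
case: ltnP => [nN|Nn].
  rewrite (bigD1 (Ordinal nN)) //= eqxx big1 ?addr0 // => k /negbTE kn.
  by rewrite (_ : (k == n :> nat) = false).
by rewrite big1 // => k _; rewrite ltn_eqF // (leq_trans (ltn_ord k)).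
Qed.

Lemma linf0_tail x : exists N c, forall n, (N <= n)%N -> x n = c.
Proof. by have /asboolP := linf0_prop x. Qed.

Lemma linf0_decompose x N c : (forall n, (N <= n)%N -> x n = c) ->
  x = \sum_(k < N) (x k - c) *: unit_seq k + c *: one_seq.
Proof.
move=> xc; have -> : \sum_(k < N) (x k - c) *: unit_seq k = truncate N (x - c *: one_seq).
  by apply: eq_bigr => k _; rewrite linf0D linf0N linf0Z mulr1.
apply: linf0_eq => n; rewrite linf0D truncateE linf0D linf0N linf0Z mulr1.
by case: ltnP => [_|/xc ->]; rewrite ?subrK ?add0r.
Qed.

Lemma unit_seq_ge0 k : (0 : linf0 R) <= unit_seq k.
Proof. by apply/linf0_leP => n; exact: ler0n. Qed.

Lemma one_seq_ge0 : (0 : linf0 R) <= one_seq.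
Proof. by apply/linf0_leP => n; exact: ler01. Qed.

Lemma linf0_archimedean : archimedean (linf0 R).
Proof.
move=> x y xy; apply/linf0_leP => n; rewrite leNgt; apply/negP => xn.
have [m my] : exists m : nat, `|y n| / x n < m%:R.
  exists (Num.bound (`|y n| / x n)); apply: archi_boundP.
  by rewrite divr_ge0 // ltW.
have /linf0_leP /(_ n) := xy m; rewrite leNgt => /negP; apply.
have -> : (x *+ m.+1) n = m.+1%:R * x n by rewrite -scaler_nat.
rewrite (le_lt_trans (ler_norm _)) // -ltr_pdivrMr // (lt_le_trans my) //.
by rewrite ler_nat.
Qed.

Lemma linf0_bounded x : exists2 M : R, 0 < M & forall n, x n <= M.
Proof.
have [N [c xc]] := linf0_tail x.
exists (1 + `|c| + \sum_(k < N) `|x k|) => [|n].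
  by rewrite ltr_wpDr ?sumr_ge0 // ltr_wpDr.
have S0 : 0 <= \sum_(k < N) `|x k| by exact: sumr_ge0.
have [nN|/xc ->] := ltnP n N; last first.
  apply: le_trans (ler_norm c) _; rewrite -addrA addrCA lerDl.
  by rewrite addr_ge0.
apply: le_trans (ler_norm _) _; rewrite (bigD1 (Ordinal nN)) //= addrCA lerDl.
by rewrite !addr_ge0 // sumr_ge0.
Qed.

End Linf0.

Lemma archimedean_le0 (R : realType) (E : povsType R) (w u : E) : archimedean E ->
  (forall m : nat, w <= m.+1%:R^-1 *: u) -> w <= 0.
Proof.
move=> arch wu; apply: (arch w u) => m.
rewrite -scaler_nat -[u](@scalerKV _ _ m.+1%:R) ?pnatr_eq0 //.
exact: povs_leZ.
Qed.

Definition nat_directed : directedSet := @DirectedSet nat leq leqnn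
  (fun j i k ij jk => leq_trans ij jk) (inhabits 0%N)
  (fun i j => ex_intro _ (maxn i j) (conj (leq_maxl i j) (leq_maxr i j))).

(** * Order continuous operators on eventually constant sequences *)

Section Operators.
Context {R : realType} {E G : rieszType R}.

HB.instance Definition _ (T : Ln E G) :=
  @GRing.isLinear.Build R E G *:%R (Ln_fun T) (Ln_linear T).

Lemma LnD (S T : Ln E G) x : (S + T) x = S x + T x. Proof. by []. Qed.
Lemma LnN (T : Ln E G) x : (- T) x = - T x. Proof. by []. Qed.

Lemma Ln_cont (T : Ln E G) : order_continuous T.
Proof. by case: T => T /= /asboolP[]. Qed.

Lemma Ln_leP (S T : Ln E G) : reflect (forall x, 0 <= x -> S x <= T x) (S <= T).
Proof. exact: asboolP. Qed.

(** Order continuity bounds [T] on [0, u]: the points y / (m + 1) with y in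
    [0, u], directed by m alone, converge to 0, and the single bound on the
    images for one value of m holds for all y simultaneously. *)
Lemma Ln_bounded (T : Ln E G) (u : E) : archimedean E -> 0 <= u ->
  exists b, forall y, 0 <= y -> y <= u -> T y <= b.
Proof.
move=> arch u0; pose I := {y : E | (0 <= y) && (y <= u)}.
pose y0 : I := exist _ 0 (introT andP (conj (lexx _) u0)).
pose D := @DirectedSet (nat * I) (fun p q => (p.1 <= q.1)%N) (fun=> leqnn _)
  (fun j i k ij jk => leq_trans ij jk) (inhabits (0%N, y0))
  (fun i j => ex_intro _ (maxn i.1 j.1, y0) (conj (leq_maxl _ _) (leq_maxr _ _))).
pose x (p : D) : E := p.1.+1%:R^-1 *: sval p.2.
have inv0 m : (0 : R) <= m.+1%:R^-1 by rewrite invr_ge0.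
have [|L [a [ad ax]]] := @Ln_cont T D x.
  exists nat_directed, (fun m => m.+1%:R^-1 *: u); split; first split.
  - move=> i j ij /=; apply: povs_scaler_leZ => //.
    by rewrite lef_pV2 ?posrE ?ltr0n // ler_nat.
  - split=> [_ [m _ <-]|w wu]; first exact: povs_scale_ge0.
    by apply: (archimedean_le0 (u := u) arch) => m; apply: wu; exists m.
  move=> m; exists (m, y0) => -[n [y yp]] /= mn; have /andP[ypos yu] := yp.
  have yum : n.+1%:R^-1 *: u <= m.+1%:R^-1 *: u.
    by apply: povs_scaler_leZ; rewrite // lef_pV2 ?posrE ?ltr0n // ler_nat.
  rewrite riesz_abs_le subr0 /x /=; apply/andP; split.
    by apply: le_trans yum; apply: povs_leZ.
  apply: (@le_trans _ _ 0); first by rewrite povs_oppr_le0 povs_scale_ge0.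
  exact: povs_scale_ge0.
have [i] := dir_inhabited L; have [[m y1] xm] := ax i.
exists (m.+1%:R *: a i) => y ypos yu.
have := xm (m, exist _ y (introT andP (conj ypos yu))) (leqnn m).
rewrite riesz_abs_le subr0 /x /= => /andP[+ _].
rewrite linearZ /= => /(@povs_leZ _ _ m.+1%:R _ _ (ler0n _ _)).
by rewrite scalerA divff ?scale1r // pnatr_eq0.
Qed.

End Operators.

Section Coordinates.
Context {R : realType} {G : rieszType R}.
Implicit Types (S T : Ln (linf0 R) G).

Lemma tail_order_cvg (x : linf0 R) : 0 <= x ->
  order_cvg (fun N : nat_directed => x - truncate N x) 0.
Proof.
move=> /linf0_leP x0.
have tailE N n : (x - truncate N x) n = if (n < N)%N then 0 else x n.
  by rewrite linf0D linf0N truncateE; case: ifP; rewrite ?subrr ?subr0.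
have tail_anti i j : (i <= j)%N -> x - truncate j x <= x - truncate i x.
  move=> ij; apply/linf0_leP => n; rewrite !tailE.
  case: (ltnP n j) => nj; case: (ltnP n i) => ni //; first exact: x0.
  by have := leq_trans ni ij; rewrite ltnNge nj.
have tail_ge0 N : 0 <= x - truncate N x.
  by apply/linf0_leP => n; rewrite tailE; case: ifP => // _; exact: x0.
exists nat_directed, (fun N => x - truncate N x); split; first split=> //.
  split=> [_ [N _ <-] //|w wlb].
  apply/linf0_leP => n; have /linf0_leP /(_ n) := wlb _ (ex_intro2 _ _ n.+1 I erefl).
  by rewrite tailE ltnSn.
move=> N; exists N => M NM; rewrite subr0 riesz_abs_le tail_anti //=.
by apply: (@le_trans _ _ 0); rewrite // povs_oppr_le0.
Qed.

Lemma linear_truncate (T : {linear linf0 R -> G}) N x :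
  T (truncate N x) = \sum_(k < N) x k *: T (unit_seq k).
Proof. by rewrite linear_sum; apply: eq_bigr => k _; rewrite linearZ. Qed.

(** A positive sequence x is the order limit of its truncations, at which the
    value of T is a positive combination of the values at the unit sequences. *)
Lemma Ln_ge0_unit T : (forall k, 0 <= T (unit_seq k)) -> 0 <= T.
Proof.
move=> T0; apply/Ln_leP => x x0; have /linf0_leP xk := x0.
have [L [a [[_ [_ al]] aT]]] := Ln_cont T (tail_order_cvg x0).
rewrite -[in X in _ <= X](opprK (T x)) -[X in X <= _](opprK) povs_leN2.
rewrite [- 0 x]oppr0; apply: al => _ [i _ <-].
have [N /(_ N (leqnn N))] := aT i.
rewrite riesz_abs_le subr0 => /andP[_ /=]; rewrite linearB opprB /=.
apply: le_trans; rewrite -[X in X <= _]add0r; apply: povs_leD => //.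
rewrite linear_truncate; apply: povs_sum_ge0 => k _.
by apply: povs_scale_ge0 (T0 k); exact: xk.
Qed.

Lemma Ln_le_unit S T :
  (forall k, S (unit_seq k) <= T (unit_seq k)) -> S <= T.
Proof.
move=> ST; rewrite -povs_subr_ge0; apply: Ln_ge0_unit => k.
by rewrite LnD LnN povs_subr_ge0.
Qed.

Lemma Ln_eq_unit S T :
  (forall k, S (unit_seq k) = T (unit_seq k)) -> S = T.
Proof. by move=> ST; apply/le_anti; rewrite !Ln_le_unit // => k; rewrite ST. Qed.

(** The sum of the positive parts is the supremum of the values of T at the sums
    of distinct unit sequences, and these lie in [0, 1].  The induction on N
    carries along a sequence [x] in [0, 1] supported on the indices from N on. *)
Lemma Ln_sum_pos_bounded T : exists b, forall N,
  \sum_(k < N) riesz_join (T (unit_seq k)) 0 <= b.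
Proof.
have [b Tb] := Ln_bounded T (@linf0_archimedean R) (@one_seq_ge0 R).
exists b => N.
suff main : forall x : linf0 R, 0 <= x -> x <= one_seq ->
    (forall k, (k < N)%N -> x k = 0) ->
    \sum_(k < N) riesz_join (T (unit_seq k)) 0 + T x <= b.
  by have := main 0 (lexx _) (@one_seq_ge0 R) (fun _ _ => erefl); rewrite linear0 addr0.
(* The N-th positive part is a join: either the N-th unit sequence is put
   into [x], or it is left out. *)
elim: N => [|N IH] x x0 x1 xN; first by rewrite big_ord0 add0r Tb.
rewrite big_ord_recr /= -addrA addrC -addrA -povs_leBrDr.
have xN0 : forall k, (k < N)%N -> x k = 0 by move=> k kN; apply/xN/leqW.
apply: riesz_join_le; rewrite povs_leBrDr; last first.
  by rewrite add0r addrC; apply: IH.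
rewrite addrA -linearD addrC; apply: IH => [||k kN].
- rewrite -[0 in X in X <= _](addr0 (0 : linf0 R)).
  by apply: povs_leD; rewrite // unit_seq_ge0.
- apply/linf0_leP => n; rewrite linf0D /=; have [->|_] := eqVneq n N.
    by rewrite xN // addr0.
  by rewrite add0r; move/linf0_leP: x1; apply.
- by rewrite linf0D /= ltn_eqF // add0r; apply: xN0.
Qed.

End Coordinates.

(** * Operators defined by positive series *)

Section Series.
Context {R : realType} {G : rieszType R}.

Lemma decreasing_small (L : directedSet) (a : L -> linf0 R) (e : R) (N : nat) (i : L) :
  decreases_to0 a -> 0 < e ->
  exists2 j, dir_le i j & forall k, (k < N)%N -> a j k <= e.
Proof.
move=> [am [a0 al]] e0; elim: N => [|N [j ij aj]].
  by exists i => //; exact: dir_refl.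
have [j' aj'] : exists j', a j' N <= e.
  apply: contrapT => /forallNP na.
  have /linf0_leP /(_ N) : e *: unit_seq N <= 0 :> linf0 R.
    apply: al => _ [j' _ <-]; apply/linf0_leP => n; rewrite linf0Z /=.
    have [->|_] := eqVneq n N.
      by rewrite mulr1 ltW // ltNge; apply/negP/na.
    by rewrite mulr0; have /linf0_leP := a0 _ (ex_intro2 _ _ j' I erefl); apply.
  by rewrite linf0Z /= eqxx mulr1 leNgt e0.
have [l [jl j'l]] := dir_directed j j'; exists l; first exact: dir_trans ij jl.
move=> k; rewrite ltnS leq_eqVlt => /predU1P[->|kN].
  by apply: le_trans aj'; have /linf0_leP := am _ _ j'l; apply.
by apply: le_trans (aj k kN); have /linf0_leP := am _ _ jl; apply.
Qed.

(** For a net a_j decreasing to 0, eventually a_j <= M (1 - 1_[0,N)) + e 1 with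
    a fixed M and any N and e, whence T a_j has infimum 0 since T 1 is the
    supremum of the values T 1_[0,N). *)
Lemma positive_order_continuous (T : {linear linf0 R -> G}) :
  archimedean G -> (forall x, 0 <= x -> 0 <= T x) ->
  supremums (range (fun N => T (truncate N one_seq))) (T one_seq) ->
  order_continuous T.
Proof.
move=> arch T0 [Tu Tl].
have Tm x y : x <= y -> T x <= T y.
  by move=> xy; rewrite -povs_subr_ge0 -linearB T0 // povs_subr_ge0.
move=> D x [L [a [ad ax]]]; have [am [a0 al]] := ad.
exists L, (T \o a); split; last first.
  move=> i; have [d0 xa] := ax i; exists d0 => d /xa.
  by rewrite !riesz_abs_le !subr0 /= -linearN => /andP[? ?]; rewrite !Tm.
split=> [i j ij /=|]; first by apply/Tm/am.
split=> [_ [i _ <-]|w wT]; first by apply: T0; apply: a0; exists i.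
apply: (archimedean_le0 (u := T one_seq) arch) => m; set e := _^-1.
have e0 : 0 < e by rewrite invr_gt0.
have [i] := dir_inhabited L; have [M M0 aM] := linf0_bounded (a i).
have M1 : 0 <= M^-1 by rewrite invr_ge0 ltW.
have wle N : w <= e *: T one_seq + M *: (T one_seq - T (truncate N one_seq)).
  have [j ij aj] := decreasing_small N i ad e0.
  apply: le_trans (wT _ (ex_intro2 _ _ j I erefl)) _.
  rewrite -linearB -!linearZ -linearD; apply: Tm; apply/linf0_leP => n.
  rewrite linf0D !linf0Z linf0D linf0N truncateE /= mulr1.
  have [nN|_] := ltnP n N; first by rewrite subrr mulr0 addr0 aj.
  rewrite subr0 mulr1; apply: le_trans (le_trans _ (aM n)) _.
    by have /linf0_leP := am _ _ ij; apply.
  by rewrite lerDr ltW.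
suff : M *: T one_seq <= M *: T one_seq + e *: T one_seq - w.
  by rewrite -addrA povs_leDl povs_subr_ge0.
rewrite -[_ - w](scalerKV (lt0r_neq0 M0)); apply: povs_leZ; first exact: ltW.
apply: Tl => _ [N _ <-]; rewrite -[T _](scalerK (lt0r_neq0 M0)); apply: povs_leZ => //.
by rewrite povs_leBrDr addrC -povs_leBrDr [M *: _ + e *: _]addrC -addrA -scalerBr.
Qed.

Context (p : nat -> G) (s : G).

(** The value at a sequence x with x_n = c for n >= N of the linear map which
    sends the k-th unit sequence to p_k and the constant sequence 1 to s. *)
Definition series_eval (N : nat) (c : R) (x : linf0 R) : G :=
  \sum_(k < N) (x k - c) *: p k + c *: s.

Definition series_op (x : linf0 R) : G :=
  let N := projT1 (cid (linf0_tail x)) in series_eval N (x N) x.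

Lemma series_opE (N : nat) (c : R) (x : linf0 R) : (forall n, (N <= n)%N -> x n = c) ->
  series_op x = series_eval N c x.
Proof.
have widen N' d c' : (forall n, (N' <= n)%N -> x n = c') ->
    series_eval (N' + d) c' x = series_eval N' c' x.
  move=> xc; elim: d => [|d IH]; first by rewrite addn0.
  rewrite -IH addnS /series_eval big_ord_recr /= xc ?leq_addr // subrr scale0r.
  by rewrite addr0.
move=> xc; rewrite /series_op; case: cid => M /= [c' xc'].
have cc : c' = c by rewrite -(xc (maxn M N)) ?leq_maxr // xc' // leq_maxl.
rewrite {}cc in xc'; rewrite (xc' M) // -(widen M (N - M)%N c) //.
by rewrite -(widen N (M - N)%N c) // -!maxnE maxnC.
Qed.

Lemma series_op_linear : linear series_op.
Proof.
move=> a x y; have [N [c xc]] := linf0_tail x; have [M [d yd]] := linf0_tail y.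
have lN : (N <= maxn N M)%N by exact: leq_maxl.
have lM : (M <= maxn N M)%N by exact: leq_maxr.
rewrite (@series_opE (maxn N M) c x) => [|n /(leq_trans lN) /xc //].
rewrite (@series_opE (maxn N M) d y) => [|n /(leq_trans lM) /yd //].
rewrite (@series_opE (maxn N M) (a * c + d)) => [|n mn]; last first.
  by rewrite linf0D linf0Z xc ?yd // (leq_trans _ mn).
rewrite /series_eval scalerDr addrACA scaler_sumr -big_split /= scalerA -scalerDl.
congr (_ + _); apply: eq_bigr => k _.
by rewrite scalerA -scalerDl opprD addrACA -mulrBr.
Qed.

Lemma series_op_unit k : series_op (unit_seq k) = p k.
Proof.
rewrite (@series_opE k.+1 0) => [|n kn]; last by rewrite /= gtn_eqF.
rewrite /series_eval scale0r addr0 big_ord_recr /= big1 ?add0r ?eqxx ?subr0 ?scale1r //.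
by move=> i _; rewrite ltn_eqF // subr0 scale0r.
Qed.

Lemma series_op_one : series_op one_seq = s.
Proof. by rewrite (@series_opE 0 1) // /series_eval big_ord0 add0r scale1r. Qed.

(** With c = x_N the value at x is sum_(k < N) x_k p_k + c (s - sum_(k < N) p_k). *)
Lemma series_op_ge0 : (forall k, 0 <= p k) -> (forall N, \sum_(k < N) p k <= s) ->
  forall x, 0 <= x -> 0 <= series_op x.
Proof.
move=> p0 ps x /linf0_leP x0; have [N [c xc]] := linf0_tail x.
rewrite (series_opE xc) /series_eval.
under eq_bigr do rewrite scalerBl.
rewrite sumrB -scaler_sumr -addrA [- _ + _]addrC -scalerBr.
rewrite -[0 in X in X <= _](addr0 (0 : G)); apply: povs_leD.
  by apply: povs_sum_ge0 => k _; apply: povs_scale_ge0; rewrite // x0.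
by apply: povs_scale_ge0; rewrite ?povs_subr_ge0 // -(xc N) // x0.
Qed.

Lemma series_op_Ln : archimedean G -> (forall k, 0 <= p k) ->
  supremums (range (fun N => \sum_(k < N) p k)) s ->
  series_op \in @oc_linear R (linf0 R) G.
Proof.
move=> arch p0 ps; apply/asboolP; split; first exact: series_op_linear.
pose T : {linear linf0 R -> G} :=
  HB.pack series_op (GRing.isLinear.Build R (linf0 R) G *:%R series_op series_op_linear).
have [pu _] := ps.
apply: (@positive_order_continuous T) => //.
  by apply: series_op_ge0 => // N; apply: pu; exists N.
rewrite [T one_seq]series_op_one.
suff -> : (fun N => T (truncate N one_seq)) = (fun N => \sum_(k < N) p k) by [].
apply/funext => N; rewrite linear_truncate; apply: eq_bigr => k _.
by rewrite scale1r [T _]series_op_unit.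
Qed.

End Series.

(** * The Riesz completion *)

Section RieszCompletion.
Context {R : realType} {F Fs : rieszType R} {iota : {linear F -> Fs}}.
Context (clo : seq_order_closure iota).

Let emb : riesz_embedding iota.
Proof. by have [_ [[]]] := clo. Qed.

Lemma HnD (S T : Hn iota) x : (S + T) x = S x + T x. Proof. by []. Qed.
Lemma HnN (T : Hn iota) x : (- T) x = - T x. Proof. by []. Qed.

Lemma Hn_unit (T : Hn iota) k : exists q, iota q = T (unit_seq k).
Proof. by have /asboolP /(_ k) [q _ qE] := Hn_prop T; exists q. Qed.

Lemma Hn_le_unit (S T : Hn iota) :
  S <= T <-> forall k, S (unit_seq k) <= T (unit_seq k).
Proof.
rewrite -Order.le_val; split=> [/Ln_leP ST k|]; last exact: Ln_le_unit.
by apply: ST; exact: unit_seq_ge0.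
Qed.

Lemma Hn_eq_unit (S T : Hn iota) :
  (forall k, S (unit_seq k) = T (unit_seq k)) -> S = T.
Proof. by move=> ST; apply: val_inj; exact: Ln_eq_unit. Qed.

Lemma Hn_series (q : nat -> F) (s : Fs) : (forall k, 0 <= q k) ->
  supremums (range (fun N => iota (\sum_(k < N) q k))) s ->
  exists T : Hn iota, (forall k, T (unit_seq k) = iota (q k)) /\ T one_seq = s.
Proof.
move=> q0 qs; have [arch _] := clo.
have Top : series_op (iota \o q) s \in @oc_linear R (linf0 R) Fs.
  apply: series_op_Ln => // [k|]; first by rewrite /= (emb_ge0 emb).
  suff -> : (fun N => \sum_(k < N) (iota \o q) k) =
           (fun N => iota (\sum_(k < N) q k)) by [].
  by apply/funext => N; rewrite linear_sum.
have TH : MkLn Top \in unit_values_in iota.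
  by apply/asboolP => k; exists (q k); rewrite // [RHS]series_op_unit.
by exists (MkHn TH); split=> [k|]; [exact: series_op_unit|exact: series_op_one].
Qed.

Lemma Hn_bounded_series (q : nat -> F) (b : Fs) : (forall k, 0 <= q k) ->
  (forall N, \sum_(k < N) iota (q k) <= b) ->
  exists T : Hn iota, forall k, T (unit_seq k) = iota (q k).
Proof.
move=> q0 qb; have [||s sP] := closure_sup clo (f := fun N => \sum_(k < N) q k) (b := b).
- apply: homo_leq => [//|y x z|n]; first exact: le_trans.
  by rewrite big_ord_recr /= povs_leDl.
- by move=> N; rewrite linear_sum.
- by have [T [TE _]] := Hn_series q0 sP; exists T.
Qed.

(** The supremum is T + P, where P is the series of the positive parts of S - T;
    the partial sums are bounded by order continuity of S - T. *)
Lemma Hn_sup (S T : Hn iota) : exists2 U : Hn iota, supremums [set S; T] U &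
  forall k, U (unit_seq k) = riesz_join (S (unit_seq k)) (T (unit_seq k)).
Proof.
have /choice [q qE] k : exists q, iota q = riesz_join ((S - T) (unit_seq k)) 0.
  have [r rE] := Hn_unit (S - T) k; exists (riesz_join r 0).
  by rewrite (emb_join emb) rE raddf0.
have [b bP] := Ln_sum_pos_bounded (Hn_op (S - T)).
have [k|N|P PE] := @Hn_bounded_series q b.
- by rewrite -(emb_ge0 emb) qE riesz_joinr.
- by under eq_bigr do rewrite qE; exact: bP.
have UE k : (T + P) (unit_seq k) = riesz_join (S (unit_seq k)) (T (unit_seq k)).
  rewrite HnD PE qE HnD HnN; apply/le_anti/andP; split.
    rewrite addrC -povs_leBrDr.
    by apply: riesz_join_le; rewrite povs_leBrDr ?subrK ?add0r ?riesz_joinl ?riesz_joinr.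
  apply: riesz_join_le; last by rewrite povs_leDl riesz_joinr.
  by rewrite addrC -povs_leBlDr riesz_joinl.
exists (T + P) => //; split=> [V|V Vu].
  by move=> [->|->]; apply/Hn_le_unit => k; rewrite UE ?riesz_joinl ?riesz_joinr.
apply/Hn_le_unit => k; rewrite UE.
by apply: riesz_join_le; move: k; apply/Hn_le_unit/Vu; [left|right].
Qed.

Lemma incl_Ln (T : Ln (linf0 R) F) : iota \o T \in @oc_linear R (linf0 R) Fs.
Proof.
apply/asboolP; split=> [c x y|D x x0] /=; first by rewrite !linearP.
rewrite -(raddf0 iota); exact/(emb_order_cvg clo)/(Ln_cont T).
Qed.

Lemma incl_Hn (T : Ln (linf0 R) F) : MkLn (incl_Ln T) \in unit_values_in iota.
Proof. by apply/asboolP => k; exists (T (unit_seq k)). Qed.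

Definition incl (T : Ln (linf0 R) F) : Hn iota := MkHn (incl_Hn T).

(** An eventually constant sequence is a combination of unit sequences and 1, so
    the values of T all lie in F once T 1 does; order continuity then passes
    from the closure to F by [emb_order_cvg_reflect]. *)
Lemma incl_range (T : Hn iota) :
  (exists q, iota q = T one_seq) -> range incl T.
Proof.
move=> [t tE]; have /choice [q qE] := Hn_unit T.
have /choice [U UE] x : exists z, iota z = T x.
  have [N [c xc]] := linf0_tail x.
  exists (\sum_(k < N) (x k - c) *: q k + c *: t).
  rewrite [in RHS](linf0_decompose xc) !linearD !linear_sum !linearZ /= tE.
  by congr (_ + _); apply: eq_bigr => k _; rewrite !linearZ /= qE.
have Uop : U \in @oc_linear R (linf0 R) F.
  apply/asboolP; split=> [c x y|D x x0].
    by apply: (emb_inj emb); rewrite linearP !UE linearP.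
  apply: (emb_order_cvg_reflect clo); rewrite raddf0.
  suff -> : iota \o (U \o x) = T \o x by exact: Ln_cont.
  by apply/funext => d /=; rewrite UE.
exists (MkLn Uop) => //; apply/val_inj/val_inj/funext => x.
exact: UE.
Qed.

Context (sig : almost_dedekind_sigma_complete F).

(** The value y 1 is corrected to an element of F by a telescoping positive
    series; it starts beyond n, so that the coordinate n stays as it is and
    the infimum of these majorants is reached coordinate by coordinate. *)
Lemma incl_majorant (y : Hn iota) (n : nat) : exists T, [/\ range incl T, y <= T &
  T (unit_seq n) = y (unit_seq n)].
Proof.
have [g gm [gl gg]] := closure_inf_seq clo sig (y one_seq).
pose h k := g (maxn k n.+1).
have hm : {homo h : i j / (i <= j)%N >-> j <= i}.
  by move=> i j ij; apply: gm; rewrite geq_max leq_maxr leq_max ij.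
have telescope N : \sum_(k < N) (h k - h k.+1) = h 0%N - h N.
  elim: N => [|N IH]; first by rewrite big_ord0 subrr.
  by rewrite big_ord_recr /= IH addrA subrK.
have [||V [VE V1]] := @Hn_series (fun k => h k - h k.+1) (iota (h 0%N) - y one_seq).
- by move=> k; rewrite povs_subr_ge0; apply: hm.
- split=> [_ [N _ <-]|u uu].
    rewrite telescope embB; apply: povs_leD => //; rewrite povs_leN2.
    by apply: gl; exists (maxn N n.+1).
  rewrite povs_leBlDr addrC -povs_leBlDr; apply: gg => _ [k _ <-] /=.
  rewrite povs_leBlDr addrC -povs_leBlDr.
  apply: le_trans (uu _ (ex_intro2 _ _ k I erefl)).
  rewrite telescope embB; apply: povs_leD => //; rewrite povs_leN2 (emb_le emb).
  by apply: gm; exact: leq_maxl.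
exists (y + V); split.
- by apply: incl_range; exists (h 0%N); rewrite HnD V1 addrC subrK.
- apply/Hn_le_unit => k; rewrite HnD povs_leDl VE (emb_ge0 emb) povs_subr_ge0.
  exact: hm.
- by rewrite HnD VE /h maxnn (maxn_idPr (leqnSn n)) subrr raddf0 addr0.
Qed.

Lemma incl_order_dense : order_dense (range incl).
Proof.
move=> y; split=> [T [_ yT] //|w wl]; apply/Hn_le_unit => k.
have [T [iT yT <-]] := incl_majorant y k.
by have /Hn_le_unit := wl T (conj iT yT); apply.
Qed.

(** A positive [y] is recovered from the lattice operations one parity class
    at a time. If Y is the part of y on one class and Z is Y shifted by one
    index, then Y and Z are disjoint with Y 1 = Z 1, so that Y is the positive
    part of Y - Z, which takes the value 0 at 1 and thus is F-valued. *)
Lemma Hn_parity (y : Hn iota) (b : bool) : 0 <= y -> exists Y A : Hn iota,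
  [/\ range incl A, supremums [set A; 0] Y &
      forall k, Y (unit_seq k) = if odd k == b then y (unit_seq k) else 0].
Proof.
move=> y0; have /choice [q qE] := Hn_unit y.
have q0 k : 0 <= q k by rewrite -(emb_ge0 emb) qE; have /Hn_le_unit := y0; apply.
pose p k := if odd k == b then q k else 0.
pose z k := if k is k'.+1 then p k' else 0.
have p0 k : 0 <= p k by rewrite /p; case: ifP.
have z0 k : 0 <= z k by case: k => [//|k]; exact: p0.
have [||s sP] := closure_sup clo (f := fun N => \sum_(k < N) p k) (b := y one_seq).
- apply: homo_leq => [//|? ? ?|n]; first exact: le_trans.
  by rewrite big_ord_recr /= povs_leDl.
- move=> N; rewrite linear_sum; apply: (@le_trans _ _ (y (truncate N one_seq))).
    rewrite linear_truncate; apply: povs_le_sum => k _.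
    rewrite scale1r; apply: (@le_trans _ _ (iota (q k))); last by rewrite qE.
    by rewrite (emb_le emb) /p; case: ifP.
  move: y0; rewrite -Order.le_val => /Ln_leP y0.
  rewrite -povs_subr_ge0 -linearB; apply: y0; apply/linf0_leP => n.
  by rewrite linf0D linf0N truncateE; case: ifP; rewrite ?subrr ?subr0.
have [Y [YE Y1]] := Hn_series p0 sP.
have [|Z [ZE Z1]] := @Hn_series z s z0.
  have [su sl] := sP; split=> [_ [[|N] _ <-]|u uu].
  - by rewrite big_ord0; apply: su; exists 0%N; rewrite // /= big_ord0.
  - by rewrite big_ord_recl add0r; apply: su; exists N.
  - apply: sl => _ [N _ <-] /=; apply: uu; exists N.+1 => //.
    by rewrite big_ord_recl add0r.
exists Y, (Y - Z); split.
- by apply: incl_range; exists 0; rewrite HnD HnN Y1 Z1 subrr raddf0.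
- have [U UP UE] := Hn_sup (Y - Z) 0.
  suff UY : U = Y by rewrite -[X in supremums _ X]UY.
  apply: Hn_eq_unit => k; rewrite UE HnD HnN YE ZE -embB.
  rewrite -[Ln_fun _ _](raddf0 iota) -(emb_join emb); congr (iota _).
  apply/le_anti/andP; split.
    by apply: riesz_join_le; rewrite // -povs_subr_ge0 opprB addrC subrK.
  have [kb|kb] := boolP (odd k == b).
    suff -> : z k = 0 by rewrite subr0 riesz_joinl.
    by case: k kb => //= k kb; rewrite /p -(eqP kb); case: (odd k).
  by rewrite /p (negbTE kb) riesz_joinr.
- by move=> k; rewrite YE /p; case: ifP; rewrite ?raddf0.
Qed.

Lemma incl_generates : generates_riesz (range incl).
Proof.
move=> H [[H0 Hlin] Hsup] inclH; rewrite -subTset => y _.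
have HD (S T : Hn iota) : H S -> H T -> H (S + T).
  by move=> HS HT; rewrite -[S]scale1r; exact: Hlin.
have Hpos (S : Hn iota) : 0 <= S -> H S.
  move=> S0; have part b := Hn_parity b S0.
  have [Y [A [iA AY YE]]] := part true; have [Z [B [iB BZ ZE]]] := part false.
  have HY : H Y := Hsup _ _ _ (inclH _ iA) H0 AY.
  have HZ : H Z := Hsup _ _ _ (inclH _ iB) H0 BZ.
  suff -> : S = Y + Z by exact: HD.
  apply: Hn_eq_unit => k; rewrite HnD YE ZE.
  by case: (odd k); rewrite ?addr0 ?add0r.
have [U [Uu _] _] := Hn_sup y 0.
have -> : y = (- 1) *: (U - y) + U by rewrite scaleN1r opprB subrK.
apply: Hlin; apply: Hpos; last by apply: Uu; right.
by rewrite povs_subr_ge0; apply: Uu; left.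
Qed.

Lemma incl_riesz_completion : riesz_completion incl.
Proof.
split.
- by move=> S T; have [U UP _] := Hn_sup S T; exists U.
- by move=> c S T; apply/val_inj/val_inj/funext => x; exact: linearP.
- move=> T; rewrite -Order.le_val; split=> /Ln_leP T0; apply/Ln_leP => x x0.
    by rewrite /= (emb_ge0 emb); exact: T0.
  by have := T0 x x0; rewrite /= (emb_ge0 emb).
- exact: incl_order_dense.
- exact: incl_generates.
Qed.

End RieszCompletion.

Theorem theorem4p11 (R : realType) (F Fs : rieszType R)
    (iota : {linear F -> Fs}) :
  almost_dedekind_sigma_complete F ->
  seq_order_closure iota ->
  exists incl : Ln (linf0 R) F -> Hn iota,
    (forall (T : Ln (linf0 R) F) (x : linf0 R), incl T x = iota (T x)) /\
    riesz_completion incl.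
Proof.
move=> sig clo; exists (incl clo); split=> //.
exact: incl_riesz_completion.
Qed.
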